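(* Consider the identification game with $d=3$, $n=2$. The maximum of the average probability of success $\mathcal{P}_{avg}^{(3)}$ over all qubit encodings $x_i\mapsto|\phi_i\rangle\in\mathbb{C}^2$ ($i=1,2,3$, unit vectors) is attained by an encoding which can be communicated by sending only a cbit (i.e. one with $|\phi_1\rangle,|\phi_2\rangle,|\phi_3\rangle\in\{|0\rangle,|1\rangle\}$ for an orthonormal basis $\{|0\rangle,|1\rangle\}$ of $\mathbb{C}^2$); but with such an encoding (sending only a cbit and attaining the maximum) the game is not won.
   Context: The game: a Referee sends Alice a value $x_i$ of a random variable with values $\{x_1,x_2,x_3\}$ (equally probable) and simultaneously sends Bob an index $j\in\{1,2,3\}$ with $x_i\in S_j$, where $S_1=\{x_1,x_2\}$, $S_2=\{x_2,x_3\}$, $S_3=\{x_3,x_1\}$; the three sets are equally probable. Alice does not know $j$, Bob knows only $j$. Alice sends Bob the pure qubit state $|\phi_i\rangle$, and Bob performs a measurement (POVM), possibly depending on $j$, which must identify the value in $S_j$ unambiguously: each outcome is either a value in $S_j$, which must never be wrong, or ''inconclusive''. No randomness or other correlations are used. The encoding and decoding are fixed in advance. The game is won if and only if for every $j$ and every $x_i\in S_j$ Bob identifies $x_i$ error-freely with nonzero probability. Individual probability of success $p_j$: the (optimal) probability of successfully and unambiguously identifying the value given that Bob received $j$; for the two equiprobable pure states $|\phi_i\rangle,|\phi_{i'}\rangle$ corresponding to $S_j=\{x_i,x_{i'}\}$ this is $p_j=1-|\langle\phi_i|\phi_{i'}\rangle|$. Average probability of success: $\mathcal{P}_{avg}^{(3)}=\frac13\sum_{j=1}^3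 p_j = 1-\frac13\big(|\langle\phi_1|\phi_2\rangle|+|\langle\phi_2|\phi_3\rangle|+|\langle\phi_3|\phi_1\rangle|\big)$. A cbit is a classical bit: Alice sends $0$ or $1$ deterministically as a function of $x_i$; this is identified with an encoding into two orthogonal states $|0\rangle,|1\rangle$. *)

(* Defs.v *)
From HB Require Import structures.
From mathcomp Require Import all_boot all_order all_algebra.
From mathcomp Require Import complex boolp classical_sets reals.

Set Implicit Arguments.
Unset Strict Implicit.
Unset Printing Implicit Defensive.

Import Order.TTheory GRing.Theory Num.Theory.

Local Open Scope ring_scope.
Local Open Scope complex_scope.

(* Kets are row vectors and operators act on the right, following dotmx:
   <u|v> is [dotmx v u], so [dotmx (v *m E) v] is <v|E|v>. *)

(* Over C the order [0 <= z] means "real and nonnegative", so this also forces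
   E to be Hermitian. *)
Definition psd (R : realType) (n : nat) (E : 'M[R[i]]_n) : Prop :=
  forall v : 'rV[R[i]]_n, 0 <= dotmx (v *m E) v.

Definition povm (R : realType) (n : nat) (T : finType)
    (E : T -> 'M[R[i]]_n) : Prop :=
  (forall t, psd (E t)) /\ \sum_t E t = 1%:M.

(* The Born rule; the bracket is already real when E is positive. *)
Definition prob (R : realType) (n : nat) (E : 'M[R[i]]_n)
    (v : 'rV[R[i]]_n) : R :=
  complex.Re (dotmx (v *m E) v).

Definition encoding (R : realType) (n : nat)
    (phi : 'I_3 -> 'rV[R[i]]_n) : Prop :=
  forall i, dotmx (phi i) (phi i) = 1.

(* [ordS] is the cyclic successor: {0,1}, {1,2}, {2,0}. *)
Definition pair_set (j : 'I_3) : {set 'I_3} := [set j; ordS j].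

(* Outcome [Some k] announces the value k, [None] is "inconclusive".  Values
   outside A are not possible outcomes, hence carry the zero operator. *)
Definition unambiguous (R : realType) (n : nat) (A : {set 'I_3})
    (phi : 'I_3 -> 'rV[R[i]]_n) (E : option 'I_3 -> 'M[R[i]]_n) : Prop :=
  [/\ povm E,
      forall k, k \notin A -> E (Some k) = 0
    & forall i k, i \in A -> k != i -> prob (E (Some k)) (phi i) = 0].

(* The values in A are equiprobable. *)
Definition success (R : realType) (n : nat) (A : {set 'I_3})
    (phi : 'I_3 -> 'rV[R[i]]_n) (E : option 'I_3 -> 'M[R[i]]_n) : R :=
  #|A|%:R^-1 * \sum_(i in A) prob (E (Some i)) (phi i).

(* The set is nonempty (always answer "inconclusive") and bounded by 1 for unit
   vectors, so [sup] is a genuine supremum; it equals 1 - |<u|v>| for the two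
   states u, v of [pair_set j] (Ivanovic-Dieks-Peres). *)
Definition p_success (R : realType) (n : nat) (phi : 'I_3 -> 'rV[R[i]]_n)
    (j : 'I_3) : R :=
  sup [set p : R | exists E : option 'I_3 -> 'M[R[i]]_n,
                     unambiguous (pair_set j) phi E /\
                     p = success (pair_set j) phi E]%classic.

Definition P_avg (R : realType) (n : nat) (phi : 'I_3 -> 'rV[R[i]]_n) : R :=
  3%:R^-1 * \sum_(j < 3) p_success phi j.

Definition maximizes_P_avg (R : realType) (n : nat)
    (phi : 'I_3 -> 'rV[R[i]]_n) : Prop :=
  encoding phi /\
  forall psi : 'I_3 -> 'rV[R[i]]_n, encoding psi -> P_avg psi <= P_avg phi.

Definition cbit_encoding (R : realType) (phi : 'I_3 -> 'rV[R[i]]_2) : Prop :=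
  exists (b : bool -> 'rV[R[i]]_2) (bit : 'I_3 -> bool),
    (forall s t, dotmx (b s) (b t) = (s == t)%:R) /\
    (forall i, phi i = b (bit i)).

Definition wins_with (R : realType) (n : nat) (phi : 'I_3 -> 'rV[R[i]]_n)
    (D : 'I_3 -> option 'I_3 -> 'M[R[i]]_n) : Prop :=
  (forall j, unambiguous (pair_set j) phi (D j)) /\
  (forall j i, i \in pair_set j -> 0 < prob (D j (Some i)) (phi i)).

(* Main.v *)
(** Three unit vectors of a plane have a singular Gram matrix; with a, b, c the
    absolute values of its off-diagonal entries this yields
    [1 <= a^2 + b^2 + c^2 + 2abc], i.e. [(c + ab)^2 >= (1 - a^2)(1 - b^2)], which
    for [a, b <= 1] forces [c + ab >= (1 - a)(1 - b)], that is
    [a + b + c >= 1].  Since an unambiguous measurement separates u and v with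
    probability at most [1 - |<u|v>|], the average success is at most 2/3, a
    value reached by |0>, |1>, |1>.  Conversely one bit for three values sends
    two of them, which form some S_j, to the same state, and these cannot be
    told apart. *)
Require Import Defs.
From mathcomp Require Import all_boot all_order all_algebra.
From mathcomp Require Import complex boolp classical_sets reals.
From mathcomp Require Import ring lra.

Set Implicit Arguments.
Unset Strict Implicit.
Unset Printing Implicit Defensive.

Import Order.TTheory GRing.Theory Num.Theory.
Local Open Scope ring_scope.

(** * A real inequality for three overlaps *)

Lemma overlap_sum_ge1 (R : realFieldType) (a b c : R) :
  0 <= a -> 0 <= b -> 0 <= c ->
  1 <= a ^+ 2 + b ^+ 2 + c ^+ 2 + 2 * (a * b * c) -> 1 <= a + b + c.
Proof.
move=> a0 b0 c0 gram; rewrite leNgt; apply/negP => lt1.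
have a1 : a < 1 by lra.
have b1 : b < 1 by lra.
have lt_ab : c + a * b < (1 - a) * (1 - b).
  have -> : (1 - a) * (1 - b) = 1 - a - b + a * b by ring.
  by rewrite ltrD2r; lra.
have : (c + a * b) ^+ 2 < ((1 - a) * (1 - b)) ^+ 2.
  by rewrite ltr_pXn2r // ?nnegrE ?addr_ge0 ?mulr_ge0 // subr_ge0 ltW.
(* The factor [2a + 2b] is [(1 + a)(1 + b) - (1 - a)(1 - b)], so this product is the gap between
   [(1 - a^2)(1 - b^2)] and [((1 - a)(1 - b))^2]. *)
have : 0 <= (1 - a) * (1 - b) * (2 * a + 2 * b).
  by rewrite !mulr_ge0 //; lra.
have -> : (c + a * b) ^+ 2 = c ^+ 2 + 2 * (a * b * c) + (a * b) ^+ 2 by ring.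
have -> : (1 - a) * (1 - b) * (2 * a + 2 * b) =
    1 - a ^+ 2 - b ^+ 2 + (a * b) ^+ 2 - ((1 - a) * (1 - b)) ^+ 2 by ring.
by lra.
Qed.

(** * Positive sesquilinear forms *)

Section PositiveForm.
Variables (C : numClosedFieldType) (n : nat) (E : 'M[C]_n).
Implicit Types u v : 'rV[C]_n.

Lemma form_mxD u v c :
  dotmx ((u + c *: v) *m E) (u + c *: v) =
  dotmx (u *m E) u + c * c^* * dotmx (v *m E) v
  + (c^* * dotmx (u *m E) v + c * dotmx (v *m E) u).
Proof.
rewrite mulmxDl -scalemxAl linearDl !linearD /= !linearZl_LR /= !linearZr_LR /=.
ring.
Qed.

(** Testing [c = 1] and [c = 'i] shows that [x + y] and ['i (y - x)] are self-conjugate; together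
    these equations give [2 'i y = 2 'i x^*]. *)
Lemma real_cross_conj (x y : C) :
  (forall c, c^* * x + c * y \is Num.real) -> y = x^*.
Proof.
move=> crossR; have /CrealP := crossR 1; have /CrealP := crossR 'i.
rewrite conjC1 conjCi !rmorphD !rmorphM !rmorphN /= conjC1 conjCi opprK.
rewrite !mul1r => crossi cross1.
have i0 : 2 * 'i != 0 :> C by rewrite mulf_neq0 ?neq0Ci ?pnatr_eq0.
apply: (mulfI i0).
transitivity ('i * (x + y) + (- 'i * x + 'i * y)); first by ring.
by rewrite -crossi -cross1; ring.
Qed.

Hypothesis E_ge0 : forall v, 0 <= dotmx (v *m E) v.

(** Polarization: the form is real at [u + c *: v], at [u] and at [v], hence so are the cross terms
    for every [c]. *)
Lemma psd_herm u v : dotmx (v *m E) u = (dotmx (u *m E) v)^*.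
Proof.
apply: real_cross_conj => c.
have -> : c^* * dotmx (u *m E) v + c * dotmx (v *m E) u =
    dotmx ((u + c *: v) *m E) (u + c *: v)
    - (dotmx (u *m E) u + c * c^* * dotmx (v *m E) v).
  by rewrite form_mxD; ring.
by rewrite !(realB, realD) ?ger0_real ?(mulr_ge0 (mul_conjC_ge0 c)).
Qed.

Lemma psd_cross u v :
  2 * `|dotmx (u *m E) v| <= dotmx (u *m E) u + dotmx (v *m E) v.
Proof.
have [->|x0] := eqVneq (dotmx (u *m E) v) 0.
  by rewrite normr0 mulr0 addr_ge0.
have nx0 : `|dotmx (u *m E) v| != 0 by rewrite normr_eq0.
(* Positivity at u - c v, where c is the phase of <u|E|v>. *)
have := E_ge0 (u + (- (dotmx (u *m E) v / `|dotmx (u *m E) v|)) *: v).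
rewrite form_mxD (psd_herm u v); move: x0 nx0.
move: (dotmx (u *m E) v) (dotmx (u *m E) u) (dotmx (v *m E) v) => x p q x0 nx0.
have xx : x * x^* = `|x| ^+ 2 by rewrite normCK.
rewrite !rmorphN !rmorphM /= fmorphV /= conj_normC.
rewrite [X in 0 <= X -> _](_ : _ = p + q * (x * x^*) / `|x| ^+ 2
  - 2 * (x * x^*) / `|x|); last by field.
by rewrite xx [X in 0 <= X -> _](_ : _ = p + q - 2 * `|x|) ?subr_ge0 //; field.
Qed.

(** Replacing [u] by [t *: u] in [psd_cross] makes the left side linear and the right side quadratic
    in [t], so a small [t] rules out a nonzero cross term. *)
Lemma psd_isotropic u v : dotmx (v *m E) v = 0 -> dotmx (u *m E) v = 0.
Proof.
move=> qv0; have [//|x0] := eqVneq (dotmx (u *m E) v) 0.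
have xp : 0 < `|dotmx (u *m E) v| by rewrite normr_gt0.
have qu0 := E_ge0 u; set x := `|dotmx (u *m E) v| in xp.
have cross (t : C) : 0 < t -> 2 * x <= t * dotmx (u *m E) u.
  move=> tp; have := psd_cross (t *: u) v.
  rewrite -!scalemxAl !linearZl_LR /= !linearZr_LR /= qv0 addr0 normrM.
  rewrite (gtr0_norm tp) (CrealP (gtr0_real tp)) -/x (mulrCA 2).
  by rewrite ler_pM2l.
have qup : 0 < dotmx (u *m E) u.
  rewrite lt0r qu0 andbT; apply/eqP => q0.
  by have := cross 1 ltr01; rewrite q0 mulr0 lt_geF // mulr_gt0.
(* This [t] turns the bound into [2 x <= x]. *)
have := cross (x / dotmx (u *m E) u) (divr_gt0 xp qup).
by rewrite divfK ?gt_eqF // ger_pMl // lt_geF // ltr1n.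
Qed.

End PositiveForm.

(** * Overlaps of three qubit states *)

(** The 3 by 3 Gram determinant vanishes in a plane; its negative terms stand on the right. *)
Lemma gram_det_qubit (C : numClosedFieldType) (u v w : 'rV[C]_2) :
  dotmx u u * dotmx v v * dotmx w w
  + dotmx u v * dotmx v w * dotmx w u + dotmx u w * dotmx w v * dotmx v u =
  dotmx u u * (dotmx v w * dotmx w v) + dotmx v v * (dotmx w u * dotmx u w)
  + dotmx w w * (dotmx u v * dotmx v u).
Proof.
have dot2 (x y : 'rV[C]_2) : dotmx x y = x 0 0 * (y 0 0)^* + x 0 1 * (y 0 1)^*.
  rewrite dotmxE mxE big_ord_recl big_ord1 !mxE.
  by have -> : lift ord0 ord0 = 1 :> 'I_2 by exact: val_inj.
by rewrite !dot2; ring.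
Qed.

Lemma dotmxC (C : numClosedFieldType) n (u v : 'rV[C]_n) :
  dotmx v u = (dotmx u v)^*.
Proof. by rewrite (hermC (@dotmx C n)) /= expr0 mul1r. Qed.

Lemma add_conj_ge (C : numClosedFieldType) (z : C) : - (2 * `|z|) <= z + z^*.
Proof.
have zr : z + z^* \is Num.real by apply/CrealP; rewrite rmorphD /= conjCK addrC.
rewrite lerNl (le_trans (real_ler_norm _)) ?realN // normrN.
by rewrite (le_trans (ler_normD _ _)) // norm_conjC -mulr2n mulr_natl.
Qed.

(** For unit vectors the Gram identity reads [|x|^2 + |y|^2 + |z|^2 = 1 + 2 Re (x y z)], and
    [Re (x y z) >= - |x y z|]. *)
Lemma qubit_overlaps_sqr (C : numClosedFieldType) (u v w : 'rV[C]_2) :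
  dotmx u u = 1 -> dotmx v v = 1 -> dotmx w w = 1 ->
  1 <= `|dotmx u v| ^+ 2 + `|dotmx v w| ^+ 2 + `|dotmx w u| ^+ 2
    + 2 * (`|dotmx u v| * `|dotmx v w| * `|dotmx w u|).
Proof.
move=> u1 v1 w1; have := gram_det_qubit u v w.
rewrite u1 v1 w1 !mul1r (dotmxC w u) (dotmxC v w) (dotmxC u v) -!normCK.
have := add_conj_ge (dotmx u v * dotmx v w * dotmx w u).
rewrite !normrM !rmorphM /=.
move: (dotmx u v) (dotmx v w) (dotmx w u) => x y z zge gram.
have -> : `|x| ^+ 2 + `|y| ^+ 2 + `|z| ^+ 2 =
   1 + (x * y * z + x^* * y^* * z^*).
  by rewrite -addrA addrC -gram; ring.
by rewrite -addrA lerDl -lerBlDr sub0r.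
Qed.

(** The modulus is a real element of [R[i]]; [complex.Re] moves it to [R], where the order is
    total. *)
Definition overlap (R : realType) n (u v : 'rV[R[i]]_n) : R :=
  complex.Re `|dotmx u v|.

Lemma overlapE (R : realType) n (u v : 'rV[R[i]]_n) :
  `|dotmx u v| = (overlap u v)%:C%C.
Proof. by rewrite RRe_real // normr_real. Qed.

Lemma overlap_ge0 (R : realType) n (u v : 'rV[R[i]]_n) : 0 <= overlap u v.
Proof. by rewrite -ler0c -overlapE. Qed.

Lemma qubit_overlaps (R : realType) (u v w : 'rV[R[i]]_2) :
  dotmx u u = 1 -> dotmx v v = 1 -> dotmx w w = 1 ->
  1 <= overlap u v + overlap v w + overlap w u.
Proof.
move=> u1 v1 w1; apply: overlap_sum_ge1; rewrite ?overlap_ge0 //.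
have := qubit_overlaps_sqr u1 v1 w1.
rewrite (overlapE u v) (overlapE v w) (overlapE w u).
move: (overlap u v) (overlap v w) (overlap w u) => a b c.
rewrite -3!rmorphXn -2!rmorphM -(rmorph_nat (real_complex R) 2) -rmorphM.
rewrite -3!rmorphD.
by rewrite -(rmorph1 (real_complex R)) lecR.
Qed.

Lemma big_option (R : Type) (idx : R) (op : Monoid.com_law idx) (T : finType)
    (F : option T -> R) :
  \big[op/idx]_t F t = op (F None) (\big[op/idx]_k F (Some k)).
Proof.
rewrite (bigD1 None) //=; congr (op _ _).
rewrite (reindex_omap Some id) /=; last by case.
by apply: eq_bigl => k; rewrite eqxx.
Qed.

(** * Unambiguous discrimination of two states *)

Section Discrimination.
Variables (C : numClosedFieldType) (n : nat) (T : finType).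
Variables (E : T -> 'M[C]_n) (u v : 'rV[C]_n) (t0 tu tv : T).
Hypothesis E_ge0 : forall t w, 0 <= dotmx (w *m E t) w.
Hypothesis E1 : \sum_t E t = 1%:M.
Hypotheses (tu0 : tu != t0) (tv0 : tv != t0) (tuv : tu != tv).
Hypothesis errorless_u :
  forall t, t != t0 -> t != tu -> dotmx (u *m E t) u = 0.
Hypothesis errorless_v :
  forall t, t != t0 -> t != tv -> dotmx (v *m E t) v = 0.
Hypotheses (u1 : dotmx u u = 1) (v1 : dotmx v v = 1).

Lemma dotmx_resolution x y : dotmx x y = \sum_t dotmx (x *m E t) y.
Proof.
by rewrite -[in LHS](mulmx1 x) -E1 mulmx_sumr linear_sumlz.
Qed.

(** Every outcome other than [t0] has probability zero on [u] or on [v], so it contributes nothing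
    to the inner product. The whole overlap thus sits in the inconclusive operator, where
    [psd_cross] bounds it by the inconclusive probabilities. *)
Lemma unambiguous_overlap :
  2 * `|dotmx u v| <= 2 - dotmx (u *m E tu) u - dotmx (v *m E tv) v.
Proof.
have -> : dotmx u v = dotmx (u *m E t0) v.
  rewrite dotmx_resolution (bigD1 t0) //= big1 ?addr0 // => t tt0.
  (* Outcome [tu] is impossible on [v]; any other conclusive outcome is impossible on [u], and
     hermiticity swaps the two arguments. *)
  have [->|ttu] := eqVneq t tu; first exact/psd_isotropic/errorless_v.
  rewrite (psd_herm (E_ge0 t) v u) (psd_isotropic (E_ge0 t)) ?conjC0 //.
  exact: errorless_u.
apply: le_trans (psd_cross (E_ge0 t0) u v) _.
have tot w tw : tw != t0 -> dotmx w w = 1 ->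
    (forall t, t != t0 -> t != tw -> dotmx (w *m E t) w = 0) ->
    dotmx (w *m E t0) w = 1 - dotmx (w *m E tw) w.
  move=> tw0 w1 errorless; rewrite -w1 [dotmx w w]dotmx_resolution.
  rewrite (bigD1 t0) //=.
  rewrite (bigD1 tw) //= [X in _ + (_ + X)]big1 ?addr0 ?addrK //.
  by move=> t /andP[] ? ?; apply: errorless.
rewrite (tot u tu) // (tot v tv) // le_eqVlt; apply/orP; left; apply/eqP.
ring.
Qed.

End Discrimination.

(** * Success probabilities of the game *)

Section Success.
Variables (R : realType) (n : nat) (phi : 'I_3 -> 'rV[R[i]]_n).
Hypothesis phi1 : encoding phi.
Implicit Types (i j k : 'I_3) (E : option 'I_3 -> 'M[R[i]]_n).

Lemma psd_prob (E : 'M[R[i]]_n) v : psd E -> dotmx (v *m E) v = (prob E v)%:C%C.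
Proof. by move=> psdE; rewrite /prob RRe_real // ger0_real. Qed.

Lemma ordS_neq j : j != ordS j.
Proof. by case: j => [] [|[|[|]]]. Qed.

Lemma success_pairE j E : success (pair_set j) phi E =
  2^-1 * (prob (E (Some j)) (phi j) + prob (E (Some (ordS j))) (phi (ordS j))).
Proof.
by rewrite /success /pair_set cards2 ordS_neq big_setU1 ?big_set1 ?inE ?ordS_neq.
Qed.

Lemma success_le j E : unambiguous (pair_set j) phi E ->
  success (pair_set j) phi E <= 1 - overlap (phi j) (phi (ordS j)).
Proof.
case=> -[psdE E1] Eout errorless.
(* [prob] keeps only the real part; positivity makes the bracket real, so it vanishes with
   [prob]. *)
have zero i t : i \in pair_set j -> t != None -> t != Some i ->
    dotmx (phi i *m E t) (phi i) = 0.
  case: t => // k iA _ ki.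
  by rewrite (psd_prob _ (psdE _)) errorless // -(inj_eq Some_inj).
have jA : j \in pair_set j by rewrite !inE eqxx.
have SjA : ordS j \in pair_set j by rewrite !inE eqxx orbT.
have := @unambiguous_overlap _ _ _ E (phi j) (phi (ordS j)) None
  (Some j) (Some (ordS j)) psdE E1 isT isT _ (fun t => zero j t jA)
  (fun t => zero (ordS j) t SjA) (phi1 _) (phi1 _).
rewrite (inj_eq Some_inj) ordS_neq => /(_ isT).
rewrite !(psd_prob _ (psdE _)) overlapE success_pairE.
move: (prob _ _) (prob _ _) (overlap _ _) => a b c.
rewrite -!(rmorph_nat (real_complex R) 2) -rmorphM -!rmorphB lecR.
by lra.
Qed.

(** This trivial measurement serves twice: it makes the set under [sup] nonempty for the upper
    bound, and it gives the lower bound 0. *)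
Lemma unambiguous_inconclusive (A : {set 'I_3}) :
  unambiguous A phi (fun t => if t is None then 1%:M else 0).
Proof.
have dot0 (v : 'rV[R[i]]_n) : dotmx (v *m 0) v = 0 by rewrite mulmx0 linear0l.
split=> // [|i k _ _]; last by rewrite /prob dot0.
split; last by rewrite big_option /= big1 ?addr0.
move=> [k|] v; rewrite ?dot0 // mulmx1.
exact: (dnorm_ge0 (@dotmx _ n) v).
Qed.

Lemma p_success_has_ubound j : has_ubound
  [set p : R | exists E, unambiguous (pair_set j) phi E /\
                         p = success (pair_set j) phi E]%classic.
Proof.
by exists (1 - overlap (phi j) (phi (ordS j))) => _ [E [uE ->]]; exact: success_le.
Qed.

Lemma success_le_p_success j E : unambiguous (pair_set j) phi E ->
  success (pair_set j) phi E <= p_success phi j.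
Proof.
by move=> uE; apply: (ub_le_sup (p_success_has_ubound j)); exists E.
Qed.

Lemma p_success_le j : p_success phi j <= 1 - overlap (phi j) (phi (ordS j)).
Proof.
apply: ge_sup => [|_ [E [uE ->]]]; last exact: success_le.
by eexists; eexists; split; first exact: unambiguous_inconclusive.
Qed.

Lemma p_success_ge0 j : 0 <= p_success phi j.
Proof.
apply: le_trans (success_le_p_success (unambiguous_inconclusive _)).
by rewrite success_pairE /prob !mulmx0 !linear0l [complex.Re 0]/(0 : R) addr0 mulr0.
Qed.

End Success.

(** * Encodings into basis states *)

Section ClassicalEncoding.
Variables (R : realType) (c : 'I_3 -> 'I_2).
Let phi (k : 'I_3) : 'rV[R[i]]_2 := delta_mx 0 (c k).

Lemma dotmx_delta (x y : 'I_2) :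
  dotmx (delta_mx 0 x : 'rV[R[i]]_2) (delta_mx 0 y) = (x == y)%:R.
Proof.
rewrite dotmxE mxE (bigD1 x) //= big1 => [|z zx]; rewrite !mxE !eqxx /=.
  by rewrite mul1r addr0 conjC_nat.
by rewrite (negPf zx) mul0r.
Qed.

Lemma classical_encoding : encoding phi.
Proof. by move=> k; rewrite dotmx_delta eqxx. Qed.

Lemma form_delta (x : 'I_2) (v : 'rV[R[i]]_2) :
  dotmx (v *m delta_mx x x) v = `|v 0 x| ^+ 2.
Proof.
have -> : v *m delta_mx x x = v 0 x *: delta_mx 0 x.
  apply/rowP => y; rewrite !mxE (bigD1 x) //= big1 => [|z zx].
    by rewrite addr0 !mxE !eqxx.
  by rewrite !mxE (negPf zx) mulr0.
rewrite linearZl_LR /= normCK; congr (_ * _).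
rewrite dotmxE mxE (bigD1 x) //= big1 => [|z zx]; rewrite !mxE ?eqxx.
  by rewrite mul1r addr0.
by rewrite (negPf zx) mul0r.
Qed.

Lemma delta_resolution (x y : 'I_2) : x != y ->
  delta_mx x x + delta_mx y y = 1%:M :> 'M[R[i]]_2.
Proof.
move=> xy; apply/matrixP => k l; rewrite !mxE.
move: x y k l xy.
by do 4![case=> [] [|[|//]] ?] => //= _; rewrite ?(addr0, add0r).
Qed.

Lemma p_success_classical (j : 'I_3) :
  c j != c (ordS j) -> 1 <= p_success phi j.
Proof.
move=> cj.
(* Measure in the computational basis. The projectors of the two distinct labels resolve the
   identity of the plane, which leaves the zero operator for [None]. *)
pose E (t : option 'I_3) : 'M[R[i]]_2 := if t is Some k then
  if k \in pair_set j then delta_mx (c k) (c k) else 0 else 0.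
have EP k : k \in pair_set j -> E (Some k) = delta_mx (c k) (c k).
  by move=> kA; rewrite /E kA.
have probE k i : k \in pair_set j -> prob (E (Some k)) (phi i) = (c i == c k)%:R.
  move=> kA; rewrite EP // /prob form_delta mxE eqxx andTb normr_nat -natrX.
  rewrite [c k == _]eq_sym.
  by case: (c i == c k).
have jA : j \in pair_set j by rewrite !inE eqxx.
have SjA : ordS j \in pair_set j by rewrite !inE eqxx orbT.
have uE : unambiguous (pair_set j) phi E.
  split=> [|k|i k iA ki]; last 2 first.
  - by rewrite /E => /negPf->.
  - have [kA|kA] := boolP (k \in pair_set j); last first.
      by rewrite /E (negPf kA) /prob mulmx0 linear0l.
    rewrite probE //; move: iA kA ki cj; rewrite !inE.
    do 2![case/orP => /eqP->]; rewrite ?eqxx // => _ /negPf cjF.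
      by rewrite cjF.
    by rewrite eq_sym cjF.
  split.
    case=> [k|] v; last by rewrite mulmx0 linear0l.
    rewrite /E; case: ifP => _; last by rewrite mulmx0 linear0l.
    by rewrite form_delta exprn_ge0.
  rewrite big_option /= add0r -big_mkcond /= big_setU1 ?inE ?ordS_neq //=.
  by rewrite big_set1 delta_resolution.
apply: le_trans (success_le_p_success classical_encoding uE).
by rewrite success_pairE !probE // !eqxx -natrD mulVf ?pnatr_eq0.
Qed.

End ClassicalEncoding.

(** * The qubit maximum and the lost game *)

Lemma P_avg_qubit_le (R : realType) (psi : 'I_3 -> 'rV[R[i]]_2) :
  encoding psi -> P_avg psi <= 3^-1 * 2.
Proof.
move=> psi1; rewrite /P_avg ler_pM2l ?invr_gt0 ?ltr0n //.
pose j0 : 'I_3 := ord0; pose j1 := ordS j0; pose j2 := ordS j1.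
(* The pairs close into a cycle, so their overlaps are the three summed in [qubit_overlaps], and the
   success probabilities total at most [3 - 1]. *)
have S2 : ordS j2 = j0 by exact: val_inj.
have -> : \sum_j p_success psi j =
    p_success psi j0 + p_success psi j1 + p_success psi j2.
  rewrite !big_ord_recl big_ord0 addr0 addrA.
  have -> : lift ord0 (lift ord0 ord0) = j2 by exact: val_inj.
  by have -> : lift ord0 ord0 = j1 by exact: val_inj.
have := qubit_overlaps (psi1 j0) (psi1 j1) (psi1 j2).
have := p_success_le psi1 j0; have := p_success_le psi1 j1.
have := p_success_le psi1 j2; rewrite S2 -/j1 -/j2.
move: (overlap (psi j0) (psi j1)) (overlap (psi j1) (psi j2)) => a b.
move: (overlap (psi j2) (psi j0)) => c.
move: (p_success psi j0) (p_success psi j1) (p_success psi j2) => p q r.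
by lra.
Qed.

(** A bit that flips at every step of a cycle of odd length 3 could not return to its initial
    value. *)
Lemma cbit_repeats (bit : 'I_3 -> bool) : exists j, bit j = bit (ordS j).
Proof.
have S3 : ordS (ordS (ordS ord0)) = ord0 :> 'I_3 by exact: val_inj.
have [|n0] := eqVneq (bit ord0) (bit (ordS ord0)); first by exists ord0.
have [|n1] := eqVneq (bit (ordS ord0)) (bit (ordS (ordS ord0))).
  by exists (ordS ord0).
exists (ordS (ordS ord0)); rewrite S3.
by case: (bit ord0) (bit (ordS ord0)) (bit (ordS (ordS ord0))) n0 n1 => [] [] [].
Qed.

(** Announcing [j] has probability zero on the state of [ordS j], which is also the state of [j]. *)
Lemma not_won_of_repeat (R : realType) n (phi : 'I_3 -> 'rV[R[i]]_n) j :
  phi j = phi (ordS j) -> ~ exists D, wins_with phi D.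
Proof.
move=> eq_phi [D [unamb win]]; have [_ _ errorless] := unamb j.
have jA : j \in pair_set j by rewrite !inE eqxx.
have SjA : ordS j \in pair_set j by rewrite !inE eqxx orbT.
have := win j j jA; rewrite eq_phi errorless ?ltxx //.
exact: ordS_neq.
Qed.

Theorem proposition3 (R : realType) :
  (exists phi : 'I_3 -> 'rV[R[i]]_2, maximizes_P_avg phi /\ cbit_encoding phi) /\
  (forall phi : 'I_3 -> 'rV[R[i]]_2, maximizes_P_avg phi -> cbit_encoding phi ->
     ~ exists D : 'I_3 -> option 'I_3 -> 'M[R[i]]_2, wins_with phi D).
Proof.
split=> [|phi _ [b [bit [_ phiE]]]]; last first.
  have [j eq_bit] := cbit_repeats bit.
  by apply: (@not_won_of_repeat _ _ _ j); rewrite !phiE eq_bit.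
(* The first value goes to |0>, the other two to |1>. *)
pose x (s : bool) : 'I_2 := if s then ord_max else ord0.
pose bit (k : 'I_3) : bool := k != ord0.
exists (fun k => delta_mx 0 (x (bit k))); split; last first.
  exists (fun s => delta_mx 0 (x s)), bit; split=> // s t.
  by rewrite dotmx_delta; case: s t => [] [].
split=> [|psi psi1]; first exact: classical_encoding.
apply: le_trans (P_avg_qubit_le psi1) _.
rewrite /P_avg ler_pM2l ?invr_gt0 ?ltr0n // !big_ord_recl big_ord0 addr0.
have p_ge j := p_success_classical R (c := x \o bit) (j := j).
(* The pair of values sharing |1> contributes at least 0 and each of the other two pairs at least 1,
   for a total of 2. *)
have := p_success_ge0 (classical_encoding R (x \o bit)) (lift ord0 ord0).
have := p_ge ord0 isT; have := p_ge (lift ord0 (lift ord0 ord0)) isT.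
rewrite /=; lra.
Qed.
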